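(* Let $n\ge2$, let $\mathfrak u=\mathfrak u_{r,s}(\mathfrak{so}_{2n+1})$ be as in the context and let $\mathfrak b$ be its Hopf subalgebra generated by $e_i,\omega_i^{\pm1}$ $(1\le i\le n)$. Put $t=\prod_{i=1}^n(1+\omega_i+\cdots+\omega_i^{\ell-1})$ and $x=\widehat{\mathcal E}_1\widehat{\mathcal E}_2\cdots\widehat{\mathcal E}_n$, where $\widehat{\mathcal E}_i=\mathcal E_{i,i}^{\ell-1}\mathcal E_{i,i+1}^{\ell-1}\cdots\mathcal E_{i,n}^{\ell-1}\mathcal E_{i,n'}^{\ell-1}\mathcal E_{i,(n-1)'}^{\ell-1}\cdots\mathcal E_{i,(i+1)'}^{\ell-1}$ for $1\le i<n$ and $\widehat{\mathcal E}_n=\mathcal E_{n,n}^{\ell-1}$. Then $y=tx$ is a left integral in $\mathfrak b$, i.e. $by=\varepsilon(b)y$ for all $b\in\mathfrak b$.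
   Context: Standing setting: $r$ a primitive $d$-th and $s$ a primitive $d'$-th root of unity, $r^3\ne s^3$, $r^4\ne s^4$, $\ell=\mathrm{lcm}(d,d')$ odd, $\mathbb K=\mathbb Q(r,s)$. $U_{r,s}(\mathfrak{so}_{2n+1})$ is generated by $e_i,f_i,\omega_i^{\pm1},\omega_i'^{\pm1}$ ($1\le i\le n$) with: $\omega$'s commute, invertible; $\omega_je_i\omega_j^{-1}=\langle\omega_i',\omega_j\rangle e_i$, $\omega_jf_i\omega_j^{-1}=\langle\omega_i',\omega_j\rangle^{-1}f_i$, $\omega_j'e_i\omega_j'^{-1}=\langle\omega_j',\omega_i\rangle^{-1}e_i$, $\omega_j'f_i\omega_j'^{-1}=\langle\omega_j',\omega_i\rangle f_i$, where $\langle\omega_i',\omega_i\rangle=r^2s^{-2}$ ($i<n$), $\langle\omega_n',\omega_n\rangle=rs^{-1}$, $\langle\omega_i',\omega_{i+1}\rangle=r^{-2}$, $\langle\omega_{i+1}',\omega_i\rangle=s^2$, others $1$; $e_if_j-f_je_i=\delta_{ij}(\omega_i-\omega_i')/(r_i-s_i)$ ($r_i=r^2,s_i=s^2$ for $i<n$; $r_n=r,s_n=s$); Serre relations $(\mathrm{ad}_le_i)^{1-a_{ij}}(e_j)=0=(\mathrm{ad}_rf_i)^{1-a_{ij}}(f_j)$, $i\ne j$, $(a_{ij})$ the $B_n$ Cartan matrix ($a_{n,n-1}=-2$, $a_{n-1,n}=-1$). Hopf structure: $\omega$'s group-like, $\Delta(e_i)=e_i\otimes1+\omega_i\otimes e_i$,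 $\Delta(f_i)=1\otimes f_i+f_i\otimes\omega_i'$, $\varepsilon(e_i)=0$, $\varepsilon(\omega_i)=1$, $S(e_i)=-\omega_i^{-1}e_i$, $S(f_i)=-f_i\omega_i'^{-1}$. Root vectors $\mathcal E_{i,i}=e_i$, $\mathcal E_{i,j}=e_i\mathcal E_{i+1,j}-r^2\mathcal E_{i+1,j}e_i$ ($i<j\le n$), $\mathcal E_{i,n'}=\mathcal E_{i,n}e_n-rs\,e_n\mathcal E_{i,n}$, $\mathcal E_{i,j'}=\mathcal E_{i,(j+1)'}e_j-s^{-2}e_j\mathcal E_{i,(j+1)'}$ ($i<j<n$); $\mathcal F$'s: $\mathcal F_{i,i}=f_i$, $\mathcal F_{i,j}=\mathcal F_{i+1,j}f_i-s^2f_i\mathcal F_{i+1,j}$, $\mathcal F_{i,n'}=f_n\mathcal F_{i,n}-rs\,\mathcal F_{i,n}f_n$, $\mathcal F_{i,j'}=f_j\mathcal F_{i,(j+1)'}-r^{-2}\mathcal F_{i,(j+1)'}f_j$. $\mathfrak u_{r,s}(\mathfrak{so}_{2n+1})$ is the quotient Hopf algebra of $U_{r,s}(\mathfrak{so}_{2n+1})$ by the ideal generated by all $\mathcal E_{k,j}^\ell,\mathcal E_{k,j'}^\ell,\mathcal F_{k,j}^\ell,\mathcal F_{k,j'}^\ell,\omega_k^\ell-1,(\omega_k')^\ell-1$; the images of root vectors in $\mathfrak u$ are denoted by the same symbols. *)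

(* Defs.v *)
From HB Require Import structures.
From mathcomp Require Import all_boot all_order all_algebra.
Set Implicit Arguments. Unset Strict Implicit. Unset Printing Implicit Defensive.
Import Order.TTheory GRing.Theory Num.Theory.
Local Open Scope ring_scope.

(* Two-parameter small quantum group u_{r,s}(so_{2n+1}) and its Borel part.
   Generators are families indexed by nat; only indices 1..n are used. *)

Section SmallQuantumGroup.
Variables (K : fieldType) (A : algType K) (n : nat) (r s : K).
Variables (e f w wi w' w'i : nat -> A).
(* e i, f i, w i = omega_i, wi i = omega_i^{-1}, w' i = omega'_i, w'i i = omega'_i^{-1} *)

Definition idx (i : nat) : bool := (1 <= i <= n)%N.

Definition r_ (i : nat) : K := if (i < n)%N then r ^+ 2 else r.
Definition s_ (i : nat) : K := if (i < n)%N then s ^+ 2 else s.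

(* the pairing < omega'_i, omega_j > *)
Definition pairing (i j : nat) : K :=
  if i == j then (if (i < n)%N then r ^+ 2 / s ^+ 2 else r / s)
  else if j == i.+1 then r ^- 2
  else if i == j.+1 then s ^+ 2
  else 1.

Definition cartanB (i j : nat) : int :=
  if i == j then 2
  else if (i == n) && (j == n.-1) then -2
  else if (j == i.+1) || (i == j.+1) then -1
  else 0.

(* left adjoint action of e_i and right adjoint action of f_i (Hopf adjoint
   actions: ad_l(a)(b) = a_(1) b S(a_(2)), ad_r(a)(b) = S(a_(1)) b a_(2)) *)
Definition adl (i : nat) (b : A) : A := e i * b - w i * b * wi i * e i.
Definition adr (i : nat) (b : A) : A := b * f i - f i * w'i i * b * w' i.

Fixpoint Eup (i k : nat) : A :=
  match k with
  | 0 => e i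
  | k'.+1 => e i * Eup i.+1 k' - r ^+ 2 *: (Eup i.+1 k' * e i)
  end.
Definition E_ (i j : nat) : A := Eup i (j - i).
Definition Enp (i : nat) : A := E_ i n * e n - (r * s) *: (e n * E_ i n).
(* Edown i k = E_{i,(n-k)'} *)
Fixpoint Edown (i k : nat) : A :=
  match k with
  | 0 => Enp i
  | k'.+1 => Edown i k' * e (n - k'.+1) - s ^- 2 *: (e (n - k'.+1) * Edown i k')
  end.
Definition E'_ (i j : nat) : A := Edown i (n - j).

Fixpoint Fup (i k : nat) : A :=
  match k with
  | 0 => f i
  | k'.+1 => Fup i.+1 k' * f i - s ^+ 2 *: (f i * Fup i.+1 k')
  end.
Definition F_ (i j : nat) : A := Fup i (j - i).
Definition Fnp (i : nat) : A := f n * F_ i n - (r * s) *: (F_ i n * f n).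
Fixpoint Fdown (i k : nat) : A :=
  match k with
  | 0 => Fnp i
  | k'.+1 => f (n - k'.+1) * Fdown i k' - r ^- 2 *: (Fdown i k' * f (n - k'.+1))
  end.
Definition F'_ (i j : nat) : A := Fdown i (n - j).

Definition small_qgroup_rels (l : nat) : Prop :=
      (forall i j, idx i -> idx j ->
         [/\ w i * w j = w j * w i, w' i * w' j = w' j * w' i
           & w i * w' j = w' j * w i]) /\
      (forall i, idx i ->
         [/\ w i * wi i = 1, wi i * w i = 1, w' i * w'i i = 1 & w'i i * w' i = 1]) /\
      (forall i j, idx i -> idx j ->
         [/\ w j * e i * wi j = pairing i j *: e i,
             w j * f i * wi j = (pairing i j)^-1 *: f i,
             w' j * e i * w'i j = (pairing j i)^-1 *: e i
           & w' j * f i * w'i j = pairing j i *: f i]) /\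
      (forall i j, idx i -> idx j ->
         e i * f j - f j * e i =
           if i == j then (r_ i - s_ i)^-1 *: (w i - w' i) else 0) /\
      (forall i j, idx i -> idx j -> i != j ->
         iter `|1 - cartanB i j|%N (adl i) (e j) = 0 /\
         iter `|1 - cartanB i j|%N (adr i) (f j) = 0) /\
      (forall k j, idx k -> idx j -> (k <= j)%N ->
         E_ k j ^+ l = 0 /\ F_ k j ^+ l = 0) /\
      (forall k, idx k -> (k < n)%N -> Enp k ^+ l = 0 /\ Fnp k ^+ l = 0) /\
      (forall k j, idx k -> (k < j < n)%N ->
         E'_ k j ^+ l = 0 /\ F'_ k j ^+ l = 0) /\
      (forall k, idx k -> w k ^+ l = 1 /\ w' k ^+ l = 1).

Definition Ehat (l i : nat) : A :=
  (\prod_(i <= j < n.+1) E_ i j ^+ l.-1) *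
  (\prod_(0 <= k < n - i) Edown i k ^+ l.-1).

Definition t_elt (l : nat) : A :=
  \prod_(1 <= i < n.+1) (\sum_(0 <= k < l) w i ^+ k).
Definition x_elt (l : nat) : A := \prod_(1 <= i < n.+1) Ehat l i.

Definition counit_on_gens (eps : A -> K) : Prop :=
  [/\ (forall a b, eps (a + b) = eps a + eps b),
      (forall (k : K) a, eps (k *: a) = k * eps a),
      (forall a b, eps (a * b) = eps a * eps b),
      eps 1 = 1
    & (forall i, idx i ->
         [/\ eps (e i) = 0, eps (f i) = 0, eps (w i) = 1, eps (wi i) = 1
           & eps (w' i) = 1 /\ eps (w'i i) = 1])].

End SmallQuantumGroup.

Inductive gen_subalg (K : fieldType) (A : algType K) (S : A -> Prop) : A -> Prop :=
  | gs_base x : S x -> gen_subalg S x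
  | gs_one : gen_subalg S 1
  | gs_add x y : gen_subalg S x -> gen_subalg S y -> gen_subalg S (x + y)
  | gs_scale (k : K) x : gen_subalg S x -> gen_subalg S (k *: x)
  | gs_mul x y : gen_subalg S x -> gen_subalg S y -> gen_subalg S (x * y).

Definition borel_gens (K : fieldType) (A : algType K) (n : nat)
  (e w wi : nat -> A) (x : A) : Prop :=
  exists i, (1 <= i <= n)%N /\ (x = e i \/ x = w i \/ x = wi i).

(* Main.v *)
(* Moving e_k to the right through Ehat_1 ... Ehat_(k-1) only costs a scalar,
   and e_k Ehat_k starts with e_k^l = 0; hence e_k x = 0, while e_k t = t' e_k
   and omega_k t = t.  For the first point no PBW basis is needed.  Let
   v_0, ..., v_N be the root vectors of row i in the order of Ehat_i, and k > i.
   Each v_t either q-commutes with e_k or satisfies v_(t+1) = v_t e_k - c e_k v_t,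
   and consecutive v_t, v_(t+1) q-commute.  So passing e_k through v_t^(l-1)
   produces correction terms ending in v_(t+1), which the following factor
   v_(t+1)^(l-1) annihilates.  The q-commutations are propagated along the row
   from rank-two and rank-three identities implied by the Serre relations; these
   need r^2 + s^2 and r^2 + r s + s^2 to be nonzero. *)
Require Import Defs.
From HB Require Import structures.
From mathcomp Require Import all_boot all_order all_algebra.
From mathcomp Require Import ring zify.
Set Implicit Arguments. Unset Strict Implicit. Unset Printing Implicit Defensive.
Import GRing.Theory.
Local Open Scope ring_scope.

(** * Noncommutative polynomial identities by reflection *)

Section FreeAlgebra.
Variables (K : comNzRingType) (A : algType K).

Inductive ncexpr :=
  | NCvar of nat
  | NCadd of ncexpr & ncexpr
  | NCopp of ncexpr
  | NCmul of ncexpr & ncexpr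
  | NCscale of K & ncexpr.

Definition ncpoly := list (K * list nat).

Fixpoint nc_eval (env : list A) (t : ncexpr) : A :=
  match t with
  | NCvar i => List.nth i env 0
  | NCadd x y => nc_eval env x + nc_eval env y
  | NCopp x => - nc_eval env x
  | NCmul x y => nc_eval env x * nc_eval env y
  | NCscale c x => c *: nc_eval env x
  end.

Fixpoint nc_word (env : list A) (u : list nat) : A :=
  if u is i :: u' then List.nth i env 0 * nc_word env u' else 1.

Fixpoint nc_value (env : list A) (p : ncpoly) : A :=
  if p is (c, u) :: p' then c *: nc_word env u + nc_value env p' else 0.

(** Local versions of concatenation and word equality let [nc_expand] unfold a fixed list of
    constants, so that words are computed while the coefficients in [K] stay symbolic. *)
Fixpoint nc_appw (u v : list nat) : list nat :=
  if u is i :: u' then i :: nc_appw u' v else v.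

Fixpoint nc_eqw (u v : list nat) : bool :=
  match u, v with
  | nil, nil => true
  | i :: u', j :: v' => if Nat.eqb i j then nc_eqw u' v' else false
  | _, _ => false
  end.

Fixpoint nc_insert (c : K) (u : list nat) (p : ncpoly) : ncpoly :=
  if p is (d, v) :: p' then
    if nc_eqw u v then (c + d, v) :: p' else (d, v) :: nc_insert c u p'
  else (c, u) :: nil.

Fixpoint nc_add (p q : ncpoly) : ncpoly :=
  if p is (c, u) :: p' then nc_insert c u (nc_add p' q) else q.

Fixpoint nc_mono (c : K) (u : list nat) (p : ncpoly) : ncpoly :=
  if p is (d, v) :: p' then (c * d, nc_appw u v) :: nc_mono c u p' else nil.

Fixpoint nc_mul (p q : ncpoly) : ncpoly :=
  if p is (c, u) :: p' then nc_add (nc_mono c u q) (nc_mul p' q) else nil.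

Fixpoint nc_norm (t : ncexpr) : ncpoly :=
  match t with
  | NCvar i => (1, i :: nil) :: nil
  | NCadd x y => nc_add (nc_norm x) (nc_norm y)
  | NCopp x => nc_mono (-1) nil (nc_norm x)
  | NCmul x y => nc_mul (nc_norm x) (nc_norm y)
  | NCscale c x => nc_mono c nil (nc_norm x)
  end.

(** Equality in [K] is not computed, so cancelled terms remain in the list; each of them becomes a
    goal for [ring] or [field]. *)
Fixpoint nc_vanish (p : ncpoly) : Prop :=
  if p is (c, _) :: p' then c = 0 /\ nc_vanish p' else True.

Lemma nc_word_app env u v :
  nc_word env (nc_appw u v) = nc_word env u * nc_word env v.
Proof. by elim: u => [|i u IH] /=; rewrite ?mul1r // IH mulrA. Qed.

Lemma nc_eqwP u v : nc_eqw u v -> u = v.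
Proof.
elim: u v => [|i u IH] [|j v] //=.
by case: (PeanoNat.Nat.eqb_spec i j) => // -> /IH ->.
Qed.

Lemma nc_value_insert env c u p :
  nc_value env (nc_insert c u p) = c *: nc_word env u + nc_value env p.
Proof.
elim: p => [|[d v] p IH] //=; case: ifP => [/nc_eqwP -> | _] /=.
  by rewrite scalerDl addrA.
by rewrite IH addrCA.
Qed.

Lemma nc_value_add env p q :
  nc_value env (nc_add p q) = nc_value env p + nc_value env q.
Proof.
elim: p => [|[c u] p IH] /=; first by rewrite add0r.
by rewrite nc_value_insert IH addrA.
Qed.

Lemma nc_value_mono env c u p :
  nc_value env (nc_mono c u p) = c *: (nc_word env u * nc_value env p).
Proof.
elim: p => [|[d v] p IH] /=; first by rewrite mulr0 scaler0.
by rewrite IH nc_word_app mulrDr scalerDr -scalerAr scalerA.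
Qed.

Lemma nc_value_mul env p q :
  nc_value env (nc_mul p q) = nc_value env p * nc_value env q.
Proof.
elim: p => [|[c u] p IH] /=; first by rewrite mul0r.
by rewrite nc_value_add nc_value_mono IH mulrDl scalerAl.
Qed.

Lemma nc_normE env t : nc_eval env t = nc_value env (nc_norm t).
Proof.
elim: t => [i|x IHx y IHy|x IHx|x IHx y IHy|c x IHx] /=.
- by rewrite scale1r mulr1 addr0.
- by rewrite nc_value_add IHx IHy.
- by rewrite nc_value_mono IHx mul1r scaleN1r.
- by rewrite nc_value_mul IHx IHy.
- by rewrite nc_value_mono IHx mul1r.
Qed.

Lemma nc_vanishP env x y :
  nc_vanish (nc_norm (NCadd x (NCopp y))) -> nc_eval env x = nc_eval env y.
Proof.
move=> H; apply/eqP; rewrite -subr_eq0.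
have -> : nc_eval env x - nc_eval env y = nc_eval env (NCadd x (NCopp y)) by [].
rewrite nc_normE; apply/eqP; elim: (nc_norm _) H => [|[c u] p IH] //= [-> /IH ->].
by rewrite scale0r addr0.
Qed.

End FreeAlgebra.

Ltac nc_index x env :=
  match env with
  | x :: _ => constr:(O)
  | _ :: ?env' => let i := nc_index x env' in constr:(S i)
  end.

Ltac nc_reify K env t :=
  match t with
  | @GRing.add _ ?x ?y =>
      let x' := nc_reify K env x in
      let y' := nc_reify K env y in constr:(@NCadd K x' y')
  | @GRing.opp _ ?x => let x' := nc_reify K env x in constr:(@NCopp K x')
  | @GRing.mul _ ?x ?y =>
      let x' := nc_reify K env x in
      let y' := nc_reify K env y in constr:(@NCmul K x' y')
  | @GRing.scale _ _ ?c ?x =>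
      let x' := nc_reify K env x in constr:(@NCscale K c x')
  | _ => let i := nc_index t env in constr:(@NCvar K i)
  end.

(* Reduces an identity of noncommutative polynomials in the atoms [env] over
   [K] to the vanishing of the coefficient of each word. *)
Ltac nc_expand K env :=
  match goal with
  | |- ?x = ?y =>
      let x' := nc_reify K env x in
      let y' := nc_reify K env y in
      apply: (@nc_vanishP _ _ env x' y');
      lazy beta iota zeta delta [nc_norm nc_add nc_mul nc_mono nc_insert nc_eqw
        nc_appw nc_vanish PeanoNat.Nat.eqb];
      repeat split
  end.

(** * Skew brackets and their low-rank identities *)

Section SkewBracket.
Variables (K : fieldType) (A : algType K).
Implicit Types (c p q : K) (a b x y z : A).

(** Every recursive step defining the root vectors [E] is, by conversion, such a bracket. *)
Definition qbr c x y : A := x * y - c *: (y * x).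

(** The integral does not depend on the values of the scalars; their being nonzero makes the
    relation symmetric. *)
Definition qcomm x y := exists2 c, c != 0 & qbr c x y = 0.

Lemma qbr0P c x y : qbr c x y = 0 <-> x * y = c *: (y * x).
Proof. by rewrite /qbr; split=> [/eqP|->]; rewrite ?subrr // subr_eq0 => /eqP. Qed.

Lemma qbr_zeror c x : qbr c x 0 = 0.
Proof. by rewrite /qbr mulr0 mul0r scaler0 subrr. Qed.

Lemma qbr_sym c x y : c != 0 -> qbr c x y = 0 -> qbr c^-1 y x = 0.
Proof. by move=> c0 /qbr0P H; apply/qbr0P; rewrite H scalerA mulVf ?scale1r. Qed.

Lemma comm_sym x y : qbr 1 x y = 0 -> qbr 1 y x = 0.
Proof. by move/qbr_sym; rewrite invr1 oner_neq0; apply. Qed.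

(** A skew Leibniz rule: moving [z] past each word of the inner bracket produces the same total
    scalar. *)
Lemma qbr_brl c d p x y z :
  qbr c x z = 0 -> qbr d y z = 0 -> qbr (c * d) (qbr p x y) z = 0.
Proof.
move=> H1 H2.
transitivity (x * qbr d y z + d *: (qbr c x z * y)
   - p *: (y * qbr c x z + c *: (qbr d y z * x))).
  by rewrite /qbr; nc_expand K (x :: y :: z :: nil); ring.
by rewrite H1 H2 !(mulr0, mul0r, scaler0, addr0, subr0).
Qed.

Lemma qbr_brr c d p x y z :
  qbr c x y = 0 -> qbr d x z = 0 -> qbr (c * d) x (qbr p y z) = 0.
Proof.
move=> H1 H2.
transitivity (qbr c x y * z + c *: (y * qbr d x z)
   - p *: (qbr d x z * y + d *: (z * qbr c x y))).
  by rewrite /qbr; nc_expand K (x :: y :: z :: nil); ring.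
by rewrite H1 H2 !(mulr0, mul0r, scaler0, addr0, subr0).
Qed.

Lemma comm_brl p x y z :
  qbr 1 x z = 0 -> qbr 1 y z = 0 -> qbr 1 (qbr p x y) z = 0.
Proof. by move=> H1 H2; rewrite -[1](mulr1 1); apply: qbr_brl. Qed.

(** The two sides differ only by terms containing the commutator of [x] and [z]. This is what
    reduces relations for long root vectors to Serre relations between generators. *)
Lemma qbr_assoc p q x y z :
  qbr 1 x z = 0 -> qbr q (qbr p x y) z = qbr p x (qbr q y z).
Proof.
move=> H; apply/eqP; rewrite -subr_eq0; apply/eqP.
transitivity (q *: (qbr 1 x z * y) - p *: (y * qbr 1 x z)).
  by rewrite /qbr; nc_expand K (x :: y :: z :: nil); ring.
by rewrite H !(mulr0, mul0r, scaler0, subr0).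
Qed.

Lemma qcomm_sym x y : qcomm x y -> qcomm y x.
Proof. by case=> c c0 H; exists c^-1; rewrite ?invr_eq0 //; apply: qbr_sym. Qed.

Lemma comm_qcomm x y : qbr 1 x y = 0 -> qcomm x y.
Proof. by exists 1; rewrite ?oner_neq0. Qed.

Lemma qcomm_brl p x y z : qcomm x z -> qcomm y z -> qcomm (qbr p x y) z.
Proof.
by case=> c c0 H1 [d d0 H2]; exists (c * d); rewrite ?mulf_neq0 //; apply: qbr_brl.
Qed.

Lemma qcomm_brr p x y z : qcomm x y -> qcomm x z -> qcomm x (qbr p y z).
Proof.
by case=> c c0 H1 [d d0 H2]; exists (c * d); rewrite ?mulf_neq0 //; apply: qbr_brr.
Qed.

(* With S the quadratic Serre relations, (p + q) times the left-hand side is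
   (S(x,a) b - x S(a,b)) - p^2 (b S(x,a) - S(a,b) x) up to multiples of [x, b]. *)
Lemma qbr_A3 p q x a b :
  p + q != 0 -> qbr 1 x b = 0 ->
  qbr q (qbr p x a) a = 0 -> qbr q a (qbr p a b) = 0 ->
  qbr 1 (qbr p (qbr p x a) b) a = 0.
Proof.
move=> pq0 Hxb Sx Sb.
apply: (scalerI pq0); rewrite scaler0.
transitivity (qbr q (qbr p x a) a * b - x * qbr q a (qbr p a b)
  - p ^+ 2 *: (b * qbr q (qbr p x a) a) + p ^+ 2 *: (qbr q a (qbr p a b) * x)
  + (p * q) *: (qbr 1 x b * a * a) - (p * (p + q)) *: (a * qbr 1 x b * a)
  + p ^+ 2 *: (a * a * qbr 1 x b)).
  by rewrite /qbr; nc_expand K (x :: a :: b :: nil); ring.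
by rewrite Hxb Sx Sb !(mulr0, mul0r, scaler0, addr0, subr0).
Qed.

(* The coefficients solve the linear system in the words of degree (1,1,3) in
   (x, a, b); x and a play the roles of E_{i,n-1} and e_(n-1), and b of e_n. *)
Lemma qbr_B3 (r s : K) (x a b : A) :
  r != 0 -> s != 0 -> r ^+ 2 + r * s + s ^+ 2 != 0 ->
  let v := qbr (r ^+ 2) x b in
  let z := qbr (r * s) v b in
  qbr (s ^+ 2) x a = 0 -> qbr 1 v a = 0 -> qbr (s ^+ 2) z b = 0 ->
  qbr (s ^+ 2) (qbr (r * s) (qbr (r ^+ 2) a b) b) b = 0 ->
  qbr (r ^+ 2 * s ^+ 2) (qbr (s ^- 2) z a) b = 0.
Proof.
move=> r0 s0 t0 v z R1 R2 C1 C2.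
set t := _ + _ in t0.
transitivity (- (r * s * t)^-1 *: (qbr (s ^+ 2) x a * b * b * b)
  + (r / s) *: (b * qbr (s ^+ 2) x a * b * b)
  - r ^+ 4 *: (b * b * qbr (s ^+ 2) x a * b)
  + (r ^+ 8 * s ^+ 2 / t) *: (b * b * b * qbr (s ^+ 2) x a)
  + (r * s)^-1 *: (qbr 1 v a * b * b)
  - (r * (r + s)) *: (b * qbr 1 v a * b)
  + (r ^+ 4 * s ^+ 2) *: (b * b * qbr 1 v a)
  - (r ^+ 2 / (s ^+ 2 * t)) *: (a * qbr (s ^+ 2) z b)
  + (r ^+ 2 * s ^+ 2 / t) *: (qbr (s ^+ 2) z b * a)
  + (r * s * t)^-1 *: (x * qbr (s ^+ 2) (qbr (r * s) (qbr (r ^+ 2) a b) b) b)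
  - (r ^+ 5 * s / t) *: (qbr (s ^+ 2) (qbr (r * s) (qbr (r ^+ 2) a b) b) b * x)).
  rewrite /z /v /qbr /t.
  nc_expand K (x :: a :: b :: nil); try by field; rewrite ?r0 ?s0 ?t0.
by rewrite R1 R2 C1 C2 !(mulr0, mul0r, scaler0, addr0, subr0).
Qed.

(** Here [x] stands for E_{i,n-1} and [a] for e_n, so [v] is E_{i,n} and [z] is E_{i,n'}. The proof
    writes [r / s] times the bracket as a combination of the two hypotheses. *)
Lemma qbr_short (r s : K) x a : r != 0 -> s != 0 ->
  let v := qbr (r ^+ 2) x a in
  let z := qbr (r * s) v a in
  qbr (s ^+ 2) x v = 0 -> qbr (s ^+ 2) z a = 0 -> qbr (s ^+ 2) v z = 0.
Proof.
move=> r0 s0 v z H1 H2.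
have rs0 : r / s != 0 by rewrite mulf_neq0 ?invr_eq0.
apply: (scalerI rs0); rewrite scaler0.
transitivity (s ^- 2 *: (qbr (s ^+ 2) x v * a * a)
  - (r ^+ 3 / s) *: (a * qbr (s ^+ 2) x v * a)
  - r ^+ 2 *: (a * qbr (s ^+ 2) x v * a)
  + (r ^+ 5 * s) *: (a * a * qbr (s ^+ 2) x v)
  - s ^- 2 *: (x * qbr (s ^+ 2) z a) + r ^+ 4 *: (qbr (s ^+ 2) z a * x)).
  by rewrite /z /v /qbr; nc_expand K (x :: a :: nil); field; rewrite ?r0 ?s0.
by rewrite H1 H2 !(mulr0, mul0r, scaler0, addr0, subr0).
Qed.

End SkewBracket.

(** * Commutation relations along one row of root vectors *)

Section RowVectors.
Variables (K : fieldType) (A : algType K) (r s : K) (n : nat) (e : nat -> A).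
Hypotheses (r0 : r != 0) (s0 : s != 0).
Hypotheses (rs2 : r ^+ 2 + s ^+ 2 != 0) (rs3 : r ^+ 2 + r * s + s ^+ 2 != 0).
Hypothesis e_comm :
  forall i j, (0 < i)%N -> (i.+1 < j <= n)%N -> qbr 1 (e i) (e j) = 0.
Hypothesis e_serre_l : forall i, (0 < i < n)%N ->
  qbr (s ^+ 2) (e i) (qbr (r ^+ 2) (e i) (e i.+1)) = 0.
Hypothesis e_serre_r : forall i, (0 < i)%N -> (i.+1 < n)%N ->
  qbr (s ^+ 2) (qbr (r ^+ 2) (e i) (e i.+1)) (e i.+1) = 0.
Hypothesis e_serre_n : forall i, (0 < i)%N -> i.+1 = n ->
  qbr (s ^+ 2) (qbr (r * s) (qbr (r ^+ 2) (e i) (e n)) (e n)) (e n) = 0.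

(** The Serre relations rescaled for the descending half of a row, where generators are attached in
    decreasing order with the scalar [s ^- 2]. *)
Lemma e_serre_rV i : (0 < i < n)%N ->
  qbr (r ^- 2) (qbr (s ^- 2) (e i.+1) (e i)) (e i) = 0.
Proof.
move=> /e_serre_l H.
transitivity ((r ^- 2 * s ^- 2) *:
   qbr (s ^+ 2) (e i) (qbr (r ^+ 2) (e i) (e i.+1))); last by rewrite H scaler0.
by rewrite /qbr; nc_expand K (e i :: e i.+1 :: nil); field; rewrite ?r0 ?s0.
Qed.

Lemma e_serre_lV i : (0 < i)%N -> (i.+1 < n)%N ->
  qbr (r ^- 2) (e i.+1) (qbr (s ^- 2) (e i.+1) (e i)) = 0.
Proof.
move=> i0 /(e_serre_r i0) H.
transitivity ((r ^- 2 * s ^- 2) *: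
   qbr (s ^+ 2) (qbr (r ^+ 2) (e i) (e i.+1)) (e i.+1)); last by rewrite H scaler0.
by rewrite /qbr; nc_expand K (e i :: e i.+1 :: nil); field; rewrite ?r0 ?s0.
Qed.

Lemma e_comm_sym i j : (0 < j)%N -> (j.+1 < i <= n)%N -> qbr 1 (e i) (e j) = 0.
Proof. by move=> j0 ji; apply/comm_sym/e_comm. Qed.

(** The definition attaches generators on the left, whereas the row argument attaches them on the
    right. The outer bracket with [e i] can be pulled out because [e i] commutes with the new last
    generator. *)
Lemma EupS i k : (0 < i)%N -> (i + k < n)%N ->
  Eup r e i k.+1 = qbr (r ^+ 2) (Eup r e i k) (e (i + k).+1).
Proof.
elim: k i => [|k IH] i i0 ik; first by rewrite addn0.
have E j : Eup r e i j.+1 = qbr (r ^+ 2) (e i) (Eup r e i.+1 j) by [].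
rewrite !E qbr_assoc; last by apply: e_comm; lia.
have -> : (i + k.+1).+1 = (i.+1 + k).+1 by lia.
by rewrite -IH //; lia.
Qed.

Section Row.
Variables (i m : nat).
Hypotheses (i0 : (0 < i)%N) (imn : (i + m.+1 = n)%N).

(** [V k] is E_{i,i+k} for k up to m+1, and [P k] is E_{i,(n-k)'} for k up to m, so the row ends
    with [P m], which is E_{i,(i+1)'}. *)
Local Notation V := (Eup r e i).
Local Notation P := (Edown n r s e i).

Lemma VS k : (k <= m)%N -> V k.+1 = qbr (r ^+ 2) (V k) (e (i + k).+1).
Proof. by move=> km; apply: EupS => //; lia. Qed.

Lemma P0 : P 0 = qbr (r * s) (V m.+1) (e n).
Proof. by rewrite /= /Enp /E_ (_ : n - i = m.+1)%N //; lia. Qed.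

Lemma PS k : P k.+1 = qbr (s ^- 2) (P k) (e (n - k.+1)).
Proof. by []. Qed.

Lemma V_comm_far k j : (k <= m)%N -> ((i + k).+1 < j <= n)%N -> qbr 1 (V k) (e j) = 0.
Proof.
elim: k => [|k IH] km jn; first by apply: e_comm => //; lia.
rewrite VS; last by lia.
by apply: comm_brl; [apply: IH; lia | apply: e_comm; lia].
Qed.

Lemma V_serre k : (k < m)%N ->
  qbr (s ^+ 2) (qbr (r ^+ 2) (V k) (e (i + k).+1)) (e (i + k).+1) = 0.
Proof.
case: k => [|k] km; first by rewrite addn0; apply: e_serre_r; lia.
rewrite VS; last by lia.
have H : qbr 1 (V k) (e (i + k).+2) = 0 by apply: V_comm_far; lia.
rewrite addnS 2!(qbr_assoc _ _ _ H).
by rewrite e_serre_r ?qbr_zeror //; lia.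
Qed.

Lemma V_serre_n :
  qbr (s ^+ 2) (qbr (r * s) (qbr (r ^+ 2) (V m) (e n)) (e n)) (e n) = 0.
Proof.
have en : (i + m).+1 = n by lia.
case: m imn en => [|k] imn' en; first by apply: e_serre_n => //; lia.
have km : (k <= m)%N by lia.
have H : qbr 1 (V k) (e n) = 0 by apply: V_comm_far; lia.
rewrite VS // 3!(qbr_assoc _ _ _ H).
by rewrite e_serre_n ?qbr_zeror //; lia.
Qed.

(** Passing from [V k] to [V k.+1], the only generator not covered by induction is the last but one,
    [e (i + k)]; there [qbr_A3] applies. *)
Lemma V_comm_below k j : (k <= m.+1)%N -> (i < j < i + k)%N -> qbr 1 (V k) (e j) = 0.
Proof.
elim: k => [|k IH] km jn; first by lia.
rewrite VS; last by lia.
have [jk|jk] := ltnP j (i + k).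
  by apply: comm_brl; [apply: IH; lia | apply: e_comm_sym; lia].
have k0 : (0 < k)%N by lia.
have {jn jk IH} -> : j = (i + k)%N by lia.
case: k k0 km => // k _ km.
rewrite VS ?addnS; last by lia.
apply: (@qbr_A3 _ _ (r ^+ 2) (s ^+ 2)) => //.
- by apply: V_comm_far; lia.
- by apply: V_serre; lia.
- by apply: e_serre_l; lia.
Qed.

Lemma V_adj k : (k <= m)%N -> qbr (s ^+ 2) (V k) (V k.+1) = 0.
Proof.
elim: k => [|k IH] km.
  by rewrite VS // addn0; apply: e_serre_l; lia.
(* The generator attached to form [V k.+2] commutes with [V k], so the induction hypothesis extends
   two places. The generator completing [V k] to [V k.+1] commutes with [V k.+2]. *)
have VV : qbr (s ^+ 2) (V k) (V k.+2) = 0.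
  rewrite (@VS (k.+1)) // -[s ^+ 2]mulr1; apply: qbr_brr; first by apply: IH; lia.
  by apply: V_comm_far; lia.
rewrite (@VS (k)); last by lia.
rewrite -[s ^+ 2]mulr1; apply: qbr_brl => //.
by apply: comm_sym; apply: V_comm_below; lia.
Qed.

Lemma P0_en : qbr (s ^+ 2) (P 0) (e n) = 0.
Proof.
rewrite P0 VS // (_ : (i + m).+1 = n); last by lia.
exact: V_serre_n.
Qed.

Lemma V_P0 : qbr (s ^+ 2) (V m.+1) (P 0) = 0.
Proof.
have H1 := @V_adj m (leqnn m); have H2 := P0_en.
move: H1 H2; rewrite P0 VS // (_ : (i + m).+1 = n); last by lia.
exact: qbr_short.
Qed.

Lemma P_comm_below k j : (i < j)%N -> (j.+1 < n - k)%N -> qbr 1 (P k) (e j) = 0.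
Proof.
elim: k => [|k IH] ij jk.
  rewrite P0; apply: comm_brl; first by apply: V_comm_below; lia.
  by apply: e_comm_sym; lia.
rewrite PS; apply: comm_brl; first by apply: IH; lia.
by apply: e_comm_sym; lia.
Qed.

(** The first factor of the bracket [P k] commutes with [e (n - k.+1)], so it can be pulled out,
    leaving a Serre relation between two generators. *)
Lemma P_serre k : (k < m)%N ->
  qbr (r ^- 2) (qbr (s ^- 2) (P k) (e (n - k.+1))) (e (n - k.+1)) = 0.
Proof.
case: k => [|k] km.
  have H : qbr 1 (V m.+1) (e (n - 1)) = 0 by apply: V_comm_below; lia.
  rewrite P0 2!(qbr_assoc _ _ _ H).
  rewrite subn1 -{1 3}(@prednK n); last by lia.
  by rewrite e_serre_rV ?qbr_zeror //; lia.
have H : qbr 1 (P k) (e (n - k.+2)) = 0 by apply: P_comm_below; lia.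
rewrite PS 2!(qbr_assoc _ _ _ H).
have -> : (n - k.+1 = (n - k.+2).+1)%N by lia.
by rewrite e_serre_rV ?qbr_zeror //; lia.
Qed.

(** For [P k.+1], induction covers j > n-k and [P_serre] covers the newest generator. The remaining
    case j = n-k is a rank-three identity. *)
Lemma P_qcomm k j : (k <= m)%N -> (n - k <= j <= n)%N -> qcomm (P k) (e j).
Proof.
elim: k j => [|k IH] j km jn.
  have -> : j = n by lia.
  by exists (s ^+ 2); [rewrite expf_neq0 | exact: P0_en].
have [jk|jk] := ltnP (n - k) j.
  by rewrite PS; apply: qcomm_brl; [apply: IH; lia | apply/comm_qcomm/e_comm; lia].
have [->|jk'] := eqVneq j (n - k.+1)%N.
  by exists (r ^- 2); [rewrite invr_eq0 expf_neq0 | exact: P_serre].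
have {jk jk' jn} -> : j = (n - k)%N by lia.
case: k IH km => [|k] _ km.
  (* [P 1] against [e n] involves the short root, hence type B3. *)
  exists (r ^+ 2 * s ^+ 2); first by rewrite mulf_neq0 ?expf_neq0.
  have en : (i + m).+1 = n by lia.
  rewrite subn0 PS P0 VS // en; apply: qbr_B3 => //.
  - have {1}-> : m = m.-1.+1 by lia.
    have e1 : (n - 1 = (i + m.-1).+1)%N by lia.
    by rewrite VS ?e1; [apply: V_serre | ]; lia.
  - have := @V_comm_below m.+1 (n - 1)%N; rewrite VS // en; apply; lia.
  - exact: V_serre_n.
  - by have := @e_serre_n (n - 1)%N; apply; lia.
apply: comm_qcomm; rewrite !PS.
have -> : (n - k.+1 = (n - k.+2).+1)%N by lia.
(* Away from the short root the type A identity recurs, with inverted parameters. *)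
apply: (@qbr_A3 _ _ (s ^- 2) (r ^- 2)).
- have -> : s ^- 2 + r ^- 2 = (r ^+ 2 + s ^+ 2) / (r ^+ 2 * s ^+ 2).
    by field; rewrite r0 s0.
  by rewrite mulf_neq0 // invr_eq0 mulf_neq0 ?expf_neq0.
- by apply: P_comm_below; lia.
- have -> : ((n - k.+2).+1 = n - k.+1)%N by lia.
  by apply: P_serre; lia.
- by apply: e_serre_lV; lia.
Qed.

(** The argument of [V_adj] again, with [V m.+1] as the predecessor of [P 0]. *)
Lemma P_adj k : (k < m)%N -> qcomm (P k) (P k.+1).
Proof.
elim: k => [|k IH] km.
  rewrite {1}P0; apply: qcomm_brl.
    rewrite PS; apply: qcomm_brr; last by apply/comm_qcomm/V_comm_below; lia.
    by exists (s ^+ 2); [rewrite expf_neq0 | exact: V_P0].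
  by apply/qcomm_sym/P_qcomm; lia.
rewrite {1}PS; apply: qcomm_brl; last by apply/qcomm_sym/P_qcomm; lia.
rewrite (PS k.+1); apply: qcomm_brr; first by apply: IH; lia.
by apply/comm_qcomm/P_comm_below; lia.
Qed.

(* The order of the factors of Ehat_i: E_{i,i}, ..., E_{i,n}, E_{i,n'}, ...,
   E_{i,(i+1)'}, where n = i + m + 1. *)
Definition row_vector t := if (t <= m.+1)%N then V t else P (t - m.+2).

Lemma row_adj t : (t < (m + m).+2)%N -> qcomm (row_vector t) (row_vector t.+1).
Proof.
move=> tm; rewrite /row_vector; case: (ltngtP t m.+1) => tm'.
- by exists (s ^+ 2); [rewrite expf_neq0 | apply: V_adj; lia].
- have -> : (t.+1 - m.+2 = (t - m.+2).+1)%N by lia.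
  by apply: P_adj; lia.
- rewrite tm' subnn; exists (s ^+ 2); [by rewrite expf_neq0 | exact: V_P0].
Qed.

(** The generator that leads to the next vector is [e (i + t).+1] from [V t], [e n] from [V m.+1],
    and [e (n - k.+1)] from [P k]. For the last vector this would be [e i], excluded by [i < j]. *)
Lemma row_raise t j : (t <= (m + m).+2)%N -> (i < j <= n)%N ->
  qcomm (e j) (row_vector t) \/
  (t < (m + m).+2)%N /\
    exists2 c, c != 0 & row_vector t.+1 = qbr c (row_vector t) (e j).
Proof.
move=> tm ij; rewrite /row_vector; case: (ltngtP t m.+1) => tm'.
- have [jt|jt] := ltnP j (i + t).
    by left; apply/qcomm_sym/comm_qcomm/V_comm_below; lia.
  have [->|jt1] := eqVneq j (i + t).+1.
    right; split; first by lia.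
    by exists (r ^+ 2); [rewrite expf_neq0 | apply: VS; lia].
  left; apply: qcomm_sym; have [jt2|jt2] := eqVneq j (i + t)%N; last first.
    by apply/comm_qcomm/V_comm_far; lia.
  case: t jt2 tm tm' {jt jt1} => [|t] jt2 tm tm'; first by lia.
  exists (s ^+ 2); first by rewrite expf_neq0.
  by rewrite VS ?jt2 ?addnS; [apply: V_serre|]; lia.
- have [jk|jk] := leqP (n - (t - m.+2)) j.
    by left; apply/qcomm_sym/P_qcomm; lia.
  have [jk1|jk1] := eqVneq j (n - (t - m.+2).+1)%N; last first.
    by left; apply/qcomm_sym/comm_qcomm/P_comm_below; lia.
  right; split; first by lia.
  exists (s ^- 2); first by rewrite invr_eq0 expf_neq0.
  have -> : (t.+1 - m.+2 = (t - m.+2).+1)%N by lia.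
  by rewrite PS jk1.
- have [->|jn] := eqVneq j n.
    right; split; first by lia.
    by exists (r * s); rewrite ?mulf_neq0 // tm' subnn P0.
  by left; apply/qcomm_sym/comm_qcomm; rewrite tm'; apply: V_comm_below; lia.
Qed.

End Row.
End RowVectors.

(** * Moving an element through a product of powers *)

Section Passing.
Variables (K : fieldType) (A : algType K).
Implicit Types (a u v x y : A).

(** The correction has [v] as its rightmost factor, so that a power of [v] placed after it can kill
    it. *)
Definition raises a u v := exists c y, a * u = c *: (u * a) + y * v.

Lemma qcomm_raises a u v : qcomm a u -> raises a u v.
Proof. by case=> c _ /qbr0P H; exists c, 0; rewrite mul0r addr0. Qed.

Lemma qbr_raises c a u : c != 0 -> raises a u (qbr c u a).
Proof.
move=> c0; exists c^-1, (- c^-1)%:A.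
rewrite mulr_algl /qbr scalerBr scalerA mulNr mulVf // !scaleNr scale1r.
by rewrite opprK addrA subrr add0r.
Qed.

(** Each correction [y * v] meets further factors [u]; since [v] q-commutes with [u], it can be
    brought back to the right end. *)
Lemma raises_expr a u v k : raises a u v -> qcomm u v -> raises a (u ^+ k) v.
Proof.
move=> [c [y H]] /qcomm_sym [d _ /qbr0P Hvu].
elim: k => [|k [c' [y' IH]]].
  by exists 1, 0; rewrite mulr1 mul1r scale1r mul0r addr0.
exists (c' * c), (c' *: (u ^+ k * y) + d *: (y' * u)).
rewrite exprSr mulrA IH mulrDl -scalerAl -!mulrA H Hvu mulrDr scalerDr.
by rewrite -!scalerAr !scalerA mulrDl -!scalerAl !mulrA addrA.
Qed.

(* The correction terms of the passage of [a] through [U t ^+ k] end in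
   [U t.+1], hence are killed by the next factor. *)
Lemma pass_prod a (U : nat -> A) k N :
  (forall t, (t <= N)%N -> U t ^+ k.+1 = 0) ->
  (forall t, (t < N)%N -> qcomm (U t) (U t.+1)) ->
  (forall t, (t <= N)%N -> qcomm a (U t) \/
     (t < N)%N /\ exists2 c, c != 0 & U t.+1 = qbr c (U t) a) ->
  exists c, a * \prod_(0 <= t < N.+1) U t ^+ k =
            c *: (\prod_(0 <= t < N.+1) U t ^+ k * a).
Proof.
have comm0 u : qcomm u 0 by exists 1; rewrite ?oner_neq0 ?qbr_zeror.
have pass0 u : qcomm a u -> exists c, a * u ^+ k = c *: (u ^+ k * a).
  (* Pure q-commutation is raising to the zero vector. *)
  move=> /(@qcomm_raises _ _ 0) /(@raises_expr _ _ _ k) /(_ (comm0 _)).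
  by case=> c [y ->]; exists c; rewrite mulr0 addr0.
elim: N U => [|N IH] U Unil Uadj Ua.
  by rewrite big_nat1; apply: pass0; case: (Ua 0%N) => // -[].
rewrite big_nat_recl //; set T := \prod_(_ <= _ < _) _.
have [c' HT] : exists c, a * T = c *: (T * a).
  apply: (IH (fun t => U t.+1)) => t tN; [exact: Unil | exact: Uadj |].
  by have := Ua t.+1; rewrite !ltnS; apply.
suff [c Hc] : exists c, a * U 0%N ^+ k * T = c *: (U 0%N ^+ k * a * T).
  by exists (c * c'); rewrite mulrA Hc -!mulrA HT -scalerAr scalerA.
have [/pass0 [c ->] | [_ [d d0 H1]]] := Ua 0%N isT.
  by exists c; rewrite -scalerAl.
have := qbr_raises a (U 0%N) d0; rewrite -H1.
move=> /(@raises_expr _ _ _ k) /(_ (Uadj 0%N isT)) [c [y ->]]; exists c.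
have UT : U 1%N * T = 0 by rewrite /T big_nat_recl // mulrA -exprS Unil ?mul0r.
by rewrite mulrDl -(mulrA y) UT mulr0 addr0 -scalerAl.
Qed.

End Passing.

(** * From the defining relations to the action on [t_elt] and [x_elt] *)

Section Relations.
Variables (K : fieldType) (A : algType K) (r s : K) (n : nat).
Variables (e f w wi w' w'i : nat -> A) (l : nat).
Hypothesis hrel : small_qgroup_rels n r s e f w wi w' w'i l.
Hypotheses (r0 : r != 0) (s0 : s != 0).

Lemma rel_w i j : idx n i -> idx n j -> w i * w j = w j * w i.
Proof. by move=> hi hj; case: hrel => /(_ i j hi hj) []. Qed.

Lemma rel_wi i : idx n i -> w i * wi i = 1 /\ wi i * w i = 1.
Proof. by move=> hi; case: hrel => _ [/(_ i hi) []]. Qed.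

Lemma rel_we i j : idx n i -> idx n j -> w j * e i * wi j = pairing n r s i j *: e i.
Proof. by move=> hi hj; case: hrel => _ [_ [/(_ i j hi hj) []]]. Qed.

Lemma rel_serre i j : idx n i -> idx n j -> i != j ->
  iter `|1 - cartanB n i j|%N (adl e w wi i) (e j) = 0.
Proof. by move=> hi hj ij; case: hrel => _ [_ [_ [_ [/(_ i j hi hj ij) []]]]]. Qed.

Lemma rel_E k j : idx n k -> idx n j -> (k <= j)%N -> E_ r e k j ^+ l = 0.
Proof. by move=> hk hj kj; case: hrel => _ [_ [_ [_ [_ [/(_ k j hk hj kj) []]]]]]. Qed.

Lemma rel_Enp k : idx n k -> (k < n)%N -> Enp n r s e k ^+ l = 0.
Proof. by move=> hk kn; case: hrel => _ [_ [_ [_ [_ [_ [/(_ k hk kn) []]]]]]]. Qed.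

Lemma rel_E' k j : idx n k -> (k < j < n)%N -> E'_ n r s e k j ^+ l = 0.
Proof. by move=> hk kj; case: hrel => _ [_ [_ [_ [_ [_ [_ [/(_ k j hk kj) []]]]]]]]. Qed.

Lemma rel_wl k : idx n k -> w k ^+ l = 1.
Proof. by move=> hk; case: hrel => _ [_ [_ [_ [_ [_ [_ [_ /(_ k hk) []]]]]]]]. Qed.

(** On weight vectors the adjoint action is a skew bracket. As weights multiply under brackets
    ([conj_qbr]), iterated adjoint actions become nested skew brackets. *)
Lemma adl_qbr i c b : w i * b * wi i = c *: b -> adl e w wi i b = qbr c (e i) b.
Proof. by rewrite /adl => ->; rewrite -scalerAl. Qed.

Lemma conj_qbr i c p q b : idx n i ->
  w i * e i * wi i = p *: e i -> w i * b * wi i = q *: b ->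
  w i * qbr c (e i) b * wi i = (p * q) *: qbr c (e i) b.
Proof.
move=> /rel_wi[_ ww] He Hb.
have conjM x y : w i * (x * y) * wi i = w i * x * wi i * (w i * y * wi i).
  by rewrite !mulrA -(mulrA _ (wi i) (w i)) ww mulr1.
rewrite /qbr mulrBr mulrBl -scalerAr -scalerAl !conjM He Hb.
by rewrite -!scalerAl -!scalerAr !scalerA scalerBr scalerA; congr (_ - _ *: _); ring.
Qed.

Lemma serre_comm i j : (0 < i)%N -> (i.+1 < j <= n)%N -> qbr 1 (e i) (e j) = 0.
Proof.
move=> i0 ij.
have hi : idx n i by rewrite /idx; lia.
have hj : idx n j by rewrite /idx; lia.
have ij' : i != j by lia.
have := rel_serre hi hj ij'; rewrite /cartanB.
have -> : (i == j) = false by lia.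
have -> : (i == n) && (j == n.-1) = false by lia.
have -> : (j == i.+1) || (i == j.+1) = false by lia.
rewrite /= (@adl_qbr _ 1) // rel_we // /pairing.
have -> : (j == i) = false by lia.
have -> : (i == j.+1) = false by lia.
by have -> : (j == i.+1) = false by lia.
Qed.

Lemma serre_l i : (0 < i < n)%N ->
  qbr (s ^+ 2) (e i) (qbr (r ^+ 2) (e i) (e i.+1)) = 0.
Proof.
move=> hin.
have hi : idx n i by rewrite /idx; lia.
have hj : idx n i.+1 by rewrite /idx; lia.
have ij' : i != i.+1 by lia.
have := rel_serre hi hj ij'; rewrite /cartanB.
have -> : (i == i.+1) = false by lia.
have -> : (i == n) && (i.+1 == n.-1) = false by lia.
rewrite eqxx /=.
have Hj : w i * e i.+1 * wi i = s ^+ 2 *: e i.+1.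
  rewrite rel_we // /pairing eqxx.
  have -> : (i.+1 == i) = false by lia.
  by have -> : (i == i.+2) = false by lia.
have Hi : w i * e i * wi i = (r ^+ 2 / s ^+ 2) *: e i.
  by rewrite rel_we // /pairing eqxx; have -> : (i < n)%N by lia.
rewrite (adl_qbr Hj) (adl_qbr (conj_qbr _ hi Hi Hj)) => H.
(* The adjoint form has the scalars [s ^+ 2] and [r ^+ 2] in the opposite order; skew brackets with
   the same left entry commute. *)
rewrite -[RHS]H /qbr.
by nc_expand K (e i :: e i.+1 :: nil); field.
Qed.

Lemma serre_r i : (0 < i)%N -> (i.+1 < n)%N ->
  qbr (s ^+ 2) (qbr (r ^+ 2) (e i) (e i.+1)) (e i.+1) = 0.
Proof.
move=> i0 hin.
have hj : idx n i by rewrite /idx; lia.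
have hi : idx n i.+1 by rewrite /idx; lia.
have ij' : i.+1 != i by lia.
have := rel_serre hi hj ij'; rewrite /cartanB.
have -> : (i.+1 == i) = false by lia.
have -> : (i.+1 == n) && (i == n.-1) = false by lia.
rewrite eqxx orbT /=.
have Hj : w i.+1 * e i * wi i.+1 = r ^- 2 *: e i.
  rewrite rel_we // /pairing eqxx.
  by have -> : (i == i.+1) = false by lia.
have Hi : w i.+1 * e i.+1 * wi i.+1 = (r ^+ 2 / s ^+ 2) *: e i.+1.
  by rewrite rel_we // /pairing eqxx hin.
rewrite (adl_qbr Hj) (adl_qbr (conj_qbr _ hi Hi Hj)) => H.
(* Swapping the entries of a bracket of scalar c gives -c times the bracket of scalar 1/c; here c is
   [r ^+ 2], then [s ^+ 2]. *)
rewrite -[RHS](scaler0 _ (r ^+ 2 * s ^+ 2)) -[in RHS]H /qbr.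
by nc_expand K (e i :: e i.+1 :: nil); field; rewrite ?r0 ?s0.
Qed.

Lemma serre_n i : (0 < i)%N -> i.+1 = n ->
  qbr (s ^+ 2) (qbr (r * s) (qbr (r ^+ 2) (e i) (e n)) (e n)) (e n) = 0.
Proof.
move=> i0 hin.
have hj : idx n i by rewrite /idx; lia.
have hi : idx n n by rewrite /idx; lia.
have ij' : n != i by lia.
have := rel_serre hi hj ij'; rewrite /cartanB.
have -> : (n == i) = false by lia.
have -> : (n == n) && (i == n.-1) by lia.
rewrite /=.
have Hj : w n * e i * wi n = r ^- 2 *: e i.
  rewrite rel_we // /pairing hin eqxx.
  by have -> : (i == n) = false by lia.
have Hi : w n * e n * wi n = (r / s) *: e n.
  by rewrite rel_we // /pairing eqxx ltnn.
have H1 := conj_qbr (r ^- 2) hi Hi Hj.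
rewrite (adl_qbr Hj) (adl_qbr H1) (adl_qbr (conj_qbr _ hi Hi H1)) => H.
(* Three swaps, with scalars [r ^+ 2], [r * s] and [s ^+ 2]. *)
rewrite -[RHS](scaler0 _ (- (r ^+ 3 * s ^+ 3))) -[in RHS]H /qbr.
by nc_expand K (e i :: e n :: nil); field; rewrite ?r0 ?s0.
Qed.

Hypotheses (rs2 : r ^+ 2 + s ^+ 2 != 0) (rs3 : r ^+ 2 + r * s + s ^+ 2 != 0).
Hypothesis l0 : (0 < l)%N.

Lemma Ehat_row i m : (i + m.+1 = n)%N ->
  Ehat n r s e l i = \prod_(0 <= t < (m + m).+3) row_vector r s n e i m t ^+ l.-1.
Proof.
move=> imn; rewrite /Ehat.
rewrite [RHS](@big_cat_nat _ _ _ m.+2) //=; last by lia.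
congr (_ * _).
  rewrite -{1}(add0n i) big_addn (_ : n.+1 - i = m.+2)%N; last by lia.
  apply: eq_big_nat => t tm; rewrite /row_vector /E_ addnK.
  by have -> : (t <= m.+1)%N by lia.
rewrite -{1}(add0n m.+2) big_addn.
have -> : ((m + m).+3 - m.+2 = n - i)%N by lia.
apply: eq_big_nat => t tm; rewrite /row_vector addnK.
by have -> : (t + m.+2 <= m.+1)%N = false by lia.
Qed.

Lemma row_nil i m t : (0 < i)%N -> (i + m.+1 = n)%N -> (t <= (m + m).+2)%N ->
  row_vector r s n e i m t ^+ l = 0.
Proof.
move=> i0 imn tm; have hi : idx n i by rewrite /idx; lia.
rewrite /row_vector; case: leqP => tm'.
  have -> : t = (i + t - i)%N by lia.
  by apply: rel_E => //; rewrite /idx; lia.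
case: (posnP (t - m.+2)) => [->|t0]; first by apply: rel_Enp => //; lia.
have -> : (t - m.+2 = n - (n - (t - m.+2)))%N by lia.
by apply: rel_E' => //; lia.
Qed.

Lemma e_Ehat i k : (0 < i)%N -> (i < k <= n)%N ->
  exists c, e k * Ehat n r s e l i = c *: (Ehat n r s e l i * e k).
Proof.
move=> i0 ik; have imn : (i + (n - i.+1).+1 = n)%N by lia.
rewrite (Ehat_row imn); apply: pass_prod => t tm.
- by rewrite prednK //; apply: row_nil.
- by apply: (row_adj r0 s0 rs2 rs3 serre_comm serre_l serre_r serre_n).
- by apply: (row_raise r0 s0 rs2 rs3 serre_comm serre_l serre_r serre_n).
Qed.

Lemma e_Ehat0 k : idx n k -> e k * Ehat n r s e l k = 0.
Proof.
move=> hk; have := hk; rewrite /idx => hk'.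
rewrite /Ehat big_nat_recl; last by lia.
have : E_ r e k k ^+ l = 0 by apply: rel_E.
by rewrite /E_ subnn !mulrA -exprS prednK //= => ->; rewrite !mul0r.
Qed.

Lemma e_x0 k : idx n k -> e k * x_elt n r s e l = 0.
Proof.
move=> hk; have := hk; rewrite /idx => /andP[k1 kn].
rewrite /x_elt (@big_cat_nat _ _ _ k) //=; last by lia.
have pass j : (j < k)%N -> exists c, e k * \prod_(1 <= i < j.+1) Ehat n r s e l i =
    c *: (\prod_(1 <= i < j.+1) Ehat n r s e l i * e k).
  elim: j => [|j IH] jk; first by exists 1; rewrite big_geq // mulr1 mul1r scale1r.
  have [|c Hc] := IH; first by lia.
  have [||c' Hc'] := @e_Ehat j.+1 k; [by [] | by lia |].
  exists (c * c'); rewrite big_nat_recr //= mulrA Hc -scalerAl -(mulrA _ (e k)) Hc'.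
  by rewrite -scalerAr scalerA !mulrA.
have [|c] := pass k.-1; first by lia.
rewrite prednK // => Hc.
rewrite mulrA Hc (@big_ltn _ _ _ k); last by lia.
by rewrite -scalerAl -mulrA (mulrA (e k)) e_Ehat0 // mul0r mulr0 scaler0.
Qed.

Lemma e_w_power i j k : idx n i -> idx n j ->
  exists x, e i * w j ^+ k = x * e i.
Proof.
move=> hi hj; have [_ ww] := rel_wi hj; have Hwe := rel_we hi hj.
have p0 : pairing n r s i j != 0.
  rewrite /pairing; do ?case: ifP => _;
    by rewrite ?mulf_neq0 ?invr_eq0 ?expf_neq0 ?oner_neq0.
have ew : e i * w j = ((pairing n r s i j)^-1 *: w j) * e i.
  rewrite -scalerAl -[e i in LHS](scale1r) -(mulVf p0) -scalerA -Hwe.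
  by rewrite -scalerAl -(mulrA _ (wi j)) ww mulr1.
elim: k => [|k [x IH]]; first by exists 1; rewrite mulr1 mul1r.
exists (x * ((pairing n r s i j)^-1 *: w j)).
by rewrite exprSr mulrA IH -mulrA ew mulrA.
Qed.

(** The left factor can stay unspecified because [e i] annihilates [x_elt]. In this weak form the
    property is stable under sums and products. *)
Lemma e_t i : idx n i -> exists x, e i * t_elt n w l = x * e i.
Proof.
move=> hi; rewrite /t_elt big_seq.
elim/big_ind: _ => [|x y [x' Hx] [y' Hy]|j].
- by exists 1; rewrite mulr1 mul1r.
- by exists (x' * y'); rewrite mulrA Hx -mulrA Hy mulrA.
rewrite mem_index_iota => hj.
elim/big_ind: _ => [|x y [x' Hx] [y' Hy]|k _]; last by apply: e_w_power.
- by exists 0; rewrite mulr0 mul0r.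
- by exists (x' + y'); rewrite mulrDr mulrDl Hx Hy.
Qed.

(** [w i] commutes past the earlier factors and permutes cyclically the powers in its own sum, since
    [w i ^+ l = 1]. *)
Lemma w_t i : idx n i -> w i * t_elt n w l = t_elt n w l.
Proof.
move=> hi; have := hi; rewrite /idx => hi'.
have wsum : w i * (\sum_(0 <= k < l) w i ^+ k) = \sum_(0 <= k < l) w i ^+ k.
  case: l l0 (rel_wl hi) => // l' _ wl.
  rewrite mulr_sumr big_nat_recr // [RHS]big_nat_recl //= -exprS wl expr0 addrC.
  by congr (_ + _); apply: eq_bigr => k _; rewrite exprS.
have wcomm j : idx n j -> GRing.comm (w i) (\sum_(0 <= k < l) w j ^+ k).
  by move=> hj; apply: commr_sum => k _; apply/commrX/rel_w.
rewrite /t_elt (@big_cat_nat _ _ _ i) //=; try lia.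
rewrite (@big_ltn _ _ _ i); last by lia.
rewrite mulrA; have -> : w i * \prod_(1 <= j < i) (\sum_(0 <= k < l) w j ^+ k) =
    \prod_(1 <= j < i) (\sum_(0 <= k < l) w j ^+ k) * w i.
  rewrite big_nat; elim/big_ind: _ => [|x y|j hj]; first exact: commr1.
    exact: commrM.
  by apply: wcomm; rewrite /idx; lia.
by rewrite -mulrA (mulrA (w i)) wsum.
Qed.

Lemma wi_t i : idx n i -> wi i * t_elt n w l = t_elt n w l.
Proof.
by move=> hi; have [_ ww] := rel_wi hi; rewrite -{1}(w_t hi) mulrA ww mul1r.
Qed.

End Relations.

(** * The integral property *)

Lemma primitive_root_neq0 (F : fieldType) (d : nat) (z : F) :
  d.-primitive_root z -> z != 0.
Proof.
move=> hz; have := prim_expr_order hz; apply: contra_eq_neq => ->.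
by rewrite expr0n gtn_eqF ?(prim_order_gt0 hz) // eq_sym oner_neq0.
Qed.

Theorem theorem7p1 (K : fieldType) (hK : [pchar K] =i pred0)
  (r s : K) (d d' : nat)
  (hr : d.-primitive_root r) (hs : d'.-primitive_root s)
  (h3 : r ^+ 3 != s ^+ 3) (h4 : r ^+ 4 != s ^+ 4)
  (hl : odd (lcmn d d'))
  (n : nat) (hn : (2 <= n)%N)
  (A : algType K) (e f w wi w' w'i : nat -> A)
  (hrel : small_qgroup_rels n r s e f w wi w' w'i (lcmn d d'))
  (eps : A -> K) (heps : counit_on_gens n e f w wi w' w'i eps) :
  let l := lcmn d d' in
  let y := t_elt n w l * x_elt n r s e l in
  forall b : A, gen_subalg (borel_gens n e w wi) b -> b * y = eps b *: y.
Proof.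
move=> l y b.
have r0 := primitive_root_neq0 hr; have s0 := primitive_root_neq0 hs.
have l0 : (0 < l)%N by rewrite lcmn_gt0 (prim_order_gt0 hr) (prim_order_gt0 hs).
have rs2 : r ^+ 2 + s ^+ 2 != 0.
  apply: contraNneq h4 => H; rewrite -subr_eq0.
  have -> : r ^+ 4 - s ^+ 4 = (r ^+ 2 - s ^+ 2) * (r ^+ 2 + s ^+ 2) by ring.
  by rewrite H mulr0.
have rs3 : r ^+ 2 + r * s + s ^+ 2 != 0.
  apply: contraNneq h3 => H; rewrite -subr_eq0.
  have -> : r ^+ 3 - s ^+ 3 = (r - s) * (r ^+ 2 + r * s + s ^+ 2) by ring.
  by rewrite H mulr0.
case: heps => epsD epsZ epsM eps1 epsg.
(* Linearity and multiplicativity of [eps] reduce the claim to the generators. *)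
elim=> {b} [x [i [hi]] | | a b _ Ha _ Hb | c a _ Ha | a b _ Ha _ Hb].
- have [ee _ ew ewi _] := epsg i hi.
  case=> [|[|]] ->; rewrite ?ee ?ew ?ewi /y mulrA.
  + have [x' ->] := e_t hrel r0 s0 hi.
    by rewrite -mulrA (e_x0 hrel) // mulr0 scale0r.
  + by rewrite (w_t hrel) // scale1r.
  + by rewrite (wi_t hrel) // scale1r.
- by rewrite eps1 mul1r scale1r.
- by rewrite epsD mulrDl Ha Hb scalerDl.
- by rewrite epsZ -scalerAl Ha scalerA.
- by rewrite epsM -mulrA Hb -scalerAr Ha scalerA mulrC.
Qed.
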